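(* Let $q$ be a complex number with $0<|q|<1$, and let $a,c,z\in\mathbb{C}$ with $c\ne 0$ and $c,z\neq q^{-m}$ for every nonnegative integer $m$. Then $$F(a,c;z)=\frac{(z;q)_\infty}{(c;q)_\infty}\sum_{k=0}^\infty\frac{(az/c;q)_k\,(-1)^k q^{k(k-1)/2}\,c^k}{(q;q)_k\,(z;q)_k}.$$
   Context: Here $(x;q)_k=\prod_{j=0}^{k-1}(1-xq^j)$, $(x;q)_\infty=\prod_{j\ge0}(1-xq^j)$, $(x,y;q)_k=(x;q)_k(y;q)_k$, and $$F(a,c;z)=\sum_{k=0}^\infty \frac{(a;q)_k\,(-1)^k q^{k(k-1)/2}\,z^k}{(q,c;q)_k}.$$ *)

(* Defs.v *)
From Stdlib Require Import Reals Lra Lia.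
From Coquelicot Require Import Coquelicot.

Open Scope C_scope.

(* Total limit of a complex sequence, taken on real and imaginary parts;
   meaningful only for a convergent sequence, see [CLim_seq_unique]. *)
Definition CLim_seq (u : nat -> C) : C :=
  (real (Lim_seq (fun n => Re (u n))), real (Lim_seq (fun n => Im (u n)))).

(* Coquelicot's [Series] is real-valued; this is its complex analogue,
   meaningful only for a convergent series, see [CSeries_unique]. *)
Definition CSeries (u : nat -> C) : C := CLim_seq (sum_n u).

Definition ex_Cseries (u : nat -> C) : Prop :=
  @ex_series C_AbsRing C_NormedModule u.

Fixpoint qpoch (x q : C) (k : nat) : C :=
  match k with
  | O => 1
  | S j => qpoch x q j * (1 - x * q ^ j)
  end.

Definition qpoch_inf (x q : C) : C := CLim_seq (qpoch x q).

Definition qpoch_inf_cvg (x q : C) : Prop :=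
  filterlim (qpoch x q) eventually (locally (qpoch_inf x q)).

Definition F_term (q a c z : C) (k : nat) : C :=
  qpoch a q k * (- (1)) ^ k * q ^ (k * (k - 1) / 2) * z ^ k
  / (qpoch q q k * qpoch c q k).

Definition F (q a c z : C) : C := CSeries (F_term q a c z).

Lemma CLim_seq_unique (u : nat -> C) (l : C) :
  filterlim u eventually (locally l) -> CLim_seq u = l.
Proof.
intros H; unfold CLim_seq; rewrite (surjective_pairing l); f_equal.
- rewrite (is_lim_seq_unique _ (fst l)); [reflexivity|].
  refine (filterlim_comp _ _ _ u Re _ _ _ H _).
  intros P [e He]; exists e; intros y [Hy _]; exact (He _ Hy).
- rewrite (is_lim_seq_unique _ (snd l)); [reflexivity|].
  refine (filterlim_comp _ _ _ u Im _ _ _ H _).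
  intros P [e He]; exists e; intros y [_ Hy]; exact (He _ Hy).
Qed.

Lemma CSeries_unique (u : nat -> C) (l : C) :
  @is_series C_AbsRing C_NormedModule u l -> CSeries u = l.
Proof. exact (CLim_seq_unique _ l). Qed.

(* Main.v *)
(** Expanding [(c q^k;q)_oo] by Euler's q-exponential series turns
    [(c;q)_oo F(a,c;z)] into [sum_N (-1)^N q^(N(N-1)/2) P_N] with
    [P_N = sum_(k+n=N) (a;q)_k z^k c^n / ((q;q)_k (q;q)_n)].  By the q-binomial
    theorem [P_N] is the coefficient of [t^N] in
    [(azt;q)_oo / ((zt;q)_oo (ct;q)_oo)], hence it is invariant under
    [(a, z, c) -> (az/c, c, z)].  To avoid rearranging infinite double series,
    the k-th term is first weighted by [(q;q)_M / (q;q)_(M-k)]: this yields an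
    exact identity between finite sums over [k <= M], and the weights are
    bounded and tend to 1, so Tannery's theorem gives the limit. *)

Require Import Defs.
From Stdlib Require Import Reals Lra Lia.
From Coquelicot Require Import Coquelicot.

Open Scope C_scope.

(** * Finite complex sums *)

(* Fixing the carrier to [C] lets [ring] and [field] recognize sums. *)
Definition csum : (nat -> C) -> nat -> C := @sum_n C_AbelianMonoid.

Lemma csum_S (f : nat -> C) (n : nat) : csum f (S n) = csum f n + f (S n).
Proof. exact (sum_Sn f n). Qed.

Lemma csum_O (f : nat -> C) : csum f 0 = f O.
Proof. exact (sum_O f). Qed.

Lemma csum_eq (f g : nat -> C) (n : nat) :
  (forall k, (k <= n)%nat -> f k = g k) -> csum f n = csum g n.
Proof. exact (sum_n_ext_loc f g n). Qed.

Lemma csum_plus (f g : nat -> C) (n : nat) :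
  csum (fun k => f k + g k) n = csum f n + csum g n.
Proof. exact (sum_n_plus f g n). Qed.

Lemma csum_scal (x : C) (f : nat -> C) (n : nat) :
  csum (fun k => x * f k) n = x * csum f n.
Proof. exact (@sum_n_mult_l C_Ring x f n). Qed.

Lemma csum_Sl (f : nat -> C) (n : nat) :
  csum f (S n) = f O + csum (fun k => f (S k)) n.
Proof.
induction n as [|n IH].
- now rewrite csum_S, !csum_O.
- rewrite csum_S, IH, (csum_S (fun k => f (S k))); ring.
Qed.

(** Raising [M] by one adds the antidiagonal [k + n = S M]: one more term in each old row, and a new
    row consisting of a single term. *)
Lemma csum_triangle (f : nat -> nat -> C) (M : nat) :
  csum (fun k => csum (f k) (M - k)) M =
  csum (fun N => csum (fun k => f k (N - k)%nat) N) M.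
Proof.
induction M as [|M IH].
- now rewrite !csum_O.
- rewrite csum_S, (csum_S (fun N => csum _ N)), <- IH.
  rewrite (csum_S (fun k => f k _)), !Nat.sub_diag, csum_O.
  rewrite (csum_eq _ (fun k => csum (f k) (M - k) + f k (S M - k)%nat)).
  + rewrite csum_plus; ring.
  + intros k Hk; rewrite Nat.sub_succ_l by easy; apply csum_S.
Qed.

(** * Triangular exponents, q-Pochhammer symbols and the weights *)

Lemma tri_S (n : nat) : (S n * (S n - 1) / 2 = n * (n - 1) / 2 + n)%nat.
Proof.
replace (S n * (S n - 1))%nat with (n * (n - 1) + n * 2)%nat by nia.
now rewrite Nat.div_add.
Qed.

(** The cross term [k * n] is what turns [c ^ n] into [(c * q ^ k) ^ n] in the double sum. *)
Lemma tri_add (k n : nat) :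
  ((k + n) * (k + n - 1) / 2 = k * (k - 1) / 2 + n * (n - 1) / 2 + k * n)%nat.
Proof.
induction n as [|n IH].
- rewrite !Nat.add_0_r; simpl; lia.
- rewrite Nat.add_succ_r, !tri_S, IH; lia.
Qed.

Lemma qpoch_Sl (x q : C) (k : nat) : qpoch x q (S k) = (1 - x) * qpoch (x * q) q k.
Proof.
induction k as [|k IH]; [simpl; ring|].
change (qpoch x q (S (S k))) with (qpoch x q (S k) * (1 - x * q ^ S k)).
rewrite IH; simpl; ring.
Qed.

Lemma qpoch_add (x q : C) (k n : nat) :
  qpoch x q (k + n) = qpoch x q k * qpoch (x * q ^ k) q n.
Proof.
induction n as [|n IH]; [rewrite Nat.add_0_r; simpl; ring|].
rewrite Nat.add_succ_r; simpl; rewrite IH, Cpow_add_r; ring.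
Qed.

(* Equals (q;q)_M / (q;q)_{M-k} for k <= M and vanishes for k > M. *)
Fixpoint qfall (q : C) (M k : nat) : C :=
  match k with
  | O => 1
  | S j => qfall q M j * (1 - q ^ (M - j))
  end.

(** The factor with [j = M] is [1 - q ^ 0 = 0]. *)
Lemma qfall_gt (q : C) (M k : nat) : (M < k)%nat -> qfall q M k = 0.
Proof.
induction 1 as [|k _ IH]; simpl; [rewrite Nat.sub_diag; simpl|rewrite IH]; ring.
Qed.

Lemma qfall_SS (q : C) (M k : nat) : qfall q (S M) (S k) = (1 - q ^ S M) * qfall q M k.
Proof.
induction k as [|k IH]; [simpl; ring|].
change (qfall q (S M) (S (S k))) with (qfall q (S M) (S k) * (1 - q ^ (M - k))).
rewrite IH; simpl; ring.
Qed.

Lemma qfall_add (q : C) (M k n : nat) :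
  qfall q M (k + n) = qfall q M k * qfall q (M - k) n.
Proof.
induction n as [|n IH]; [rewrite Nat.add_0_r; simpl; ring|].
rewrite Nat.add_succ_r; simpl; rewrite IH, Nat.sub_add_distr; ring.
Qed.

Lemma qfall_qpoch (q : C) (M k : nat) :
  (k <= M)%nat -> qfall q M k * qpoch q q (M - k) = qpoch q q M.
Proof.
induction k as [|k IH]; intros Hk; [rewrite Nat.sub_0_r; simpl; ring|].
rewrite <- IH by lia.
replace (M - k)%nat with (S (M - S k)) by lia; simpl.
replace (M - k)%nat with (S (M - S k)) by lia; simpl; ring.
Qed.

(** * The exact identity between finite sums *)

Section FiniteIdentity.

Variable q : C.
Hypothesis hq : forall k, qpoch q q k <> 0.

Lemma one_minus_qpow_neq0 (n : nat) : 1 - q ^ S n <> 0.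
Proof. intros H; apply (hq (S n)); simpl in *; rewrite H; ring. Qed.

(** The quotient of [qfall q M n] by [qpoch q q n] is the Gaussian binomial coefficient. The
    induction compares powers of [x] in [(x;q)_{M+1} = (1-x) (xq;q)_M], so [x] must stay general. *)
Lemma finite_q_binomial (x : C) (M : nat) :
  qpoch x q M =
  csum (fun n => qfall q M n * ((- (1)) ^ n * q ^ (n * (n - 1) / 2) * x ^ n / qpoch q q n)) M.
Proof.
revert x; induction M as [|M IH]; intros x; [rewrite csum_O; simpl; field; apply C1_nz|].
set (e y n := (- (1)) ^ n * q ^ (n * (n - 1) / 2) * y ^ n / qpoch q q n).
rewrite qpoch_Sl, IH.
change (csum _ M) with (csum (fun n => qfall q M n * e (x * q) n) M).
(* Padding with the vanishing term at [S M] and splitting off index 0 aligns this sum with its copy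
   multiplied by [- x], where each power of [x] is one higher. *)
assert (E : csum (fun n => qfall q M n * e (x * q) n) M =
  1 + csum (fun n => qfall q M (S n) * e (x * q) (S n)) M).
{ transitivity (csum (fun n => qfall q M n * e (x * q) n) (S M)).
  - rewrite csum_S, qfall_gt by lia; ring.
  - rewrite csum_Sl; unfold e at 1; simpl; field; apply C1_nz. }
change (csum _ (S M)) with (csum (fun n => qfall q (S M) n * e x n) (S M)).
rewrite csum_Sl.
replace ((1 - x) * csum (fun n => qfall q M n * e (x * q) n) M) with
  (csum (fun n => qfall q M n * e (x * q) n) M + - x * csum (fun n => qfall q M n * e (x * q) n) M)
  by ring.
rewrite E at 1.
replace (qfall q (S M) 0 * e x O) with (RtoC 1) by (unfold e; simpl; field; apply C1_nz).
rewrite <- Cplus_assoc; f_equal.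
rewrite <- csum_scal, <- csum_plus.
apply csum_eq; intros n Hn.
rewrite qfall_SS; unfold e.
rewrite tri_S, Cpow_add_r, !Cpow_mult_l; simpl.
replace (q * q ^ M) with (q * q ^ n * q ^ (M - n))
  by (rewrite <- Cmult_assoc, <- Cpow_add_r; do 2 f_equal; lia).
field; split; first [apply hq | exact (one_minus_qpow_neq0 n)].
Qed.

(** By the q-binomial theorem, the coefficient of [t ^ k] in [G(t) = (azt;q)_oo / (zt;q)_oo]. *)
Definition hyp_coef (a z : C) (k : nat) : C := qpoch a q k * z ^ k / qpoch q q k.

(** Coefficient form of [(1 - zt) G(t) = (1 - azt) G(qt)]. *)
Lemma hyp_coef_S (a z : C) (k : nat) :
  (1 - q ^ S k) * hyp_coef a z (S k) = z * (1 - a * q ^ k) * hyp_coef a z k.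
Proof.
unfold hyp_coef; simpl; field; split; first [apply hq | exact (one_minus_qpow_neq0 k)].
Qed.

(** By Euler, the coefficient of [t ^ n] in [E(t) = 1 / (ct;q)_oo]. *)
Definition exp_coef (c : C) (n : nat) : C := c ^ n / qpoch q q n.

(** Coefficient form of [(1 - ct) E(t) = E(qt)]. *)
Lemma exp_coef_S (c : C) (n : nat) :
  (1 - q ^ S n) * exp_coef c (S n) = c * exp_coef c n.
Proof.
unfold exp_coef; simpl; field; split; first [apply hq | exact (one_minus_qpow_neq0 n)].
Qed.

(* The coefficient of [t ^ N] in [(azt;q)_oo / ((zt;q)_oo (ct;q)_oo)]. *)
Definition conv (a z c : C) (N : nat) : C :=
  csum (fun k => hyp_coef a z k * exp_coef c (N - k)) N.

(* With [conv] it satisfies a first-order system; eliminating it would give the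
   three-term recurrence of [conv]. *)
Definition conv_shift (a z c : C) (N : nat) : C :=
  csum (fun k => hyp_coef a z k * (q ^ (N - k) * exp_coef c (N - k))) N.

(** Coefficient of [t ^ S N] in [G(t) E(qt) = (1 - ct) G(t) E(t)]. *)
Lemma conv_shift_S (a z c : C) (N : nat) :
  conv_shift a z c (S N) = conv a z c (S N) - c * conv a z c N.
Proof.
unfold conv_shift, conv; rewrite !csum_S, Nat.sub_diag.
replace (- c * conv a z c N) with
  (csum (fun k => - c * (hyp_coef a z k * exp_coef c (N - k))) N) by apply csum_scal.
rewrite (csum_eq _ (fun k => hyp_coef a z k * exp_coef c (S N - k)
   + - c * (hyp_coef a z k * exp_coef c (N - k)))).
- rewrite csum_plus, csum_scal; simpl; ring.
- intros k Hk; rewrite Nat.sub_succ_l by easy.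
  pose proof (exp_coef_S c (N - k)) as E.
  transitivity (hyp_coef a z k * exp_coef c (S (N - k))
    - hyp_coef a z k * ((1 - q ^ S (N - k)) * exp_coef c (S (N - k)))); [ring|].
  rewrite E; ring.
Qed.

(** A product rule for q-differences: with [m = S N - k], [1 - q ^ S N = (1 - q ^ m) + q ^ m (1 - q
    ^ k)]. The first part lowers [exp_coef], the second lowers [hyp_coef]. *)
Lemma conv_S (a z c : C) (N : nat) :
  (1 - q ^ S N) * conv a z c (S N) =
  c * conv a z c N + z * conv_shift a z c N - a * z * q ^ N * conv a z c N.
Proof.
transitivity (csum (fun k => hyp_coef a z k * ((1 - q ^ (S N - k)) * exp_coef c (S N - k))) (S N)
  + csum (fun k => q ^ (S N - k) * exp_coef c (S N - k) * ((1 - q ^ k) * hyp_coef a z k)) (S N)).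
- unfold conv; rewrite <- csum_scal, <- csum_plus.
  apply csum_eq; intros k Hk.
  replace (q ^ S N) with (q ^ k * q ^ (S N - k)) by (rewrite <- Cpow_add_r; f_equal; lia).
  ring.
(* The term [k = S N] of the first sum and the term [k = 0] of the second vanish, each through a
   factor [1 - q ^ 0]. *)
- rewrite csum_S, Nat.sub_diag, (csum_Sl (fun k => q ^ (S N - k) * _ * _)).
  unfold conv, conv_shift.
  rewrite (csum_eq _ (fun k => c * (hyp_coef a z k * exp_coef c (N - k)))).
  2:{ intros k Hk; rewrite Nat.sub_succ_l, exp_coef_S by easy; ring. }
  rewrite (csum_eq (fun k => q ^ (S N - S k) * _ * _)
    (fun k => z * (hyp_coef a z k * (q ^ (N - k) * exp_coef c (N - k)))
      + - (a * z * q ^ N) * (hyp_coef a z k * exp_coef c (N - k)))).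
  2:{ intros k Hk; rewrite hyp_coef_S; simpl.
      replace (q ^ N) with (q ^ k * q ^ (N - k)) by (rewrite <- Cpow_add_r; f_equal; lia).
      ring. }
  rewrite csum_plus, !csum_scal; simpl; ring.
Qed.

(** The right side of [conv_S] also involves [conv_shift], so the induction carries the symmetry of
    [c * conv + z * conv_shift] as well. By [conv_shift_S] that combination at [S N] is
    [(c + z) * conv (S N) - c * z * conv N], which is symmetric once [conv] is. *)
Lemma conv_swap (a z a' c : C) (N : nat) : a * z = a' * c ->
  conv a z c N = conv a' c z N.
Proof.
intros Ha.
enough (H : conv a z c N = conv a' c z N /\
  c * conv a z c N + z * conv_shift a z c N =
  z * conv a' c z N + c * conv_shift a' c z N) by apply H.
induction N as [|N [IH1 IH2]].
- unfold conv, conv_shift; rewrite !csum_O; unfold hyp_coef, exp_coef; simpl.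
  split; field; apply C1_nz.
- assert (E : conv a z c (S N) = conv a' c z (S N)).
  { transitivity (((1 - q ^ S N) * conv a z c (S N)) / (1 - q ^ S N));
      [field; exact (one_minus_qpow_neq0 N)|].
    rewrite conv_S, IH2, IH1, Ha.
    replace (_ + _ - _) with ((1 - q ^ S N) * conv a' c z (S N))
      by (rewrite conv_S; ring).
    field; exact (one_minus_qpow_neq0 N). }
  split; [exact E|].
  rewrite !conv_shift_S, E, IH1; ring.
Qed.

(** Here [(c;q)_M / (c;q)_k = (cq^k;q)_{M-k}] is expanded by the finite q-binomial formula. The
    weights are chosen so that [qfall q M k * qfall q (M - k) n] depends only on [k + n]; it then
    factors out of each antidiagonal. *)
Lemma finite_sum_conv (a z c : C) (M : nat) : (forall k, qpoch c q k <> 0) ->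
  qpoch c q M * csum (fun k => qfall q M k * F_term q a c z k) M =
  csum (fun N => qfall q M N * (- (1)) ^ N * q ^ (N * (N - 1) / 2) * conv a z c N) M.
Proof.
intros hc.
pose (f k n := qfall q M (k + n) * (- (1)) ^ (k + n) * q ^ ((k + n) * (k + n - 1) / 2)
  * (hyp_coef a z k * exp_coef c n)).
transitivity (csum (fun k => csum (f k) (M - k)) M).
- rewrite <- csum_scal; apply csum_eq; intros k Hk.
  transitivity (qfall q M k * (- (1)) ^ k * q ^ (k * (k - 1) / 2) * hyp_coef a z k
    * qpoch (c * q ^ k) q (M - k)).
  + replace (qpoch c q M) with (qpoch c q k * qpoch (c * q ^ k) q (M - k))
      by (rewrite <- qpoch_add; f_equal; lia).
    unfold F_term, hyp_coef; field; split; first [apply hc | apply hq].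
  + rewrite finite_q_binomial, <- csum_scal; apply csum_eq; intros n Hn.
    unfold f, exp_coef.
    rewrite qfall_add, tri_add, !Cpow_add_r, Cpow_mult_l, Cpow_mult_r.
    field; apply hq.
- rewrite csum_triangle; apply csum_eq; intros N HN.
  unfold conv; rewrite <- csum_scal; apply csum_eq; intros k Hk.
  unfold f; now rewrite (Nat.add_comm k), Nat.sub_add.
Qed.

End FiniteIdentity.

(** * Limits of complex sequences *)

(** Reduces complex limits to real limits of moduli, where squeezing and the real limit rules
    apply. *)
Lemma Clim_iff (u : nat -> C) (l : C) :
  filterlim u eventually (locally l) <-> is_lim_seq (fun n => Cmod (u n - l)) 0.
Proof.
rewrite <- is_lim_seq_spec.
split.
- intros H eps.
  destruct (proj1 (@filterlim_locally_ball_norm C_AbsRing nat C_NormedModule eventually _ u l) H eps)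
    as [N HN].
  exists N; intros n Hn; rewrite Rminus_0_r, Rabs_pos_eq by apply Cmod_ge_0.
  exact (HN n Hn).
- intros H; apply (@filterlim_locally_ball_norm C_AbsRing nat C_NormedModule eventually _ u l).
  intros eps; destruct (H eps) as [N HN].
  exists N; intros n Hn; specialize (HN n Hn).
  rewrite Rminus_0_r, Rabs_pos_eq in HN by apply Cmod_ge_0; exact HN.
Qed.

Lemma is_lim_seq_squeeze0 (u v : nat -> R) :
  (forall n, (0 <= u n <= v n)%R) -> is_lim_seq v 0 -> is_lim_seq u 0.
Proof.
intros H Hv; apply (is_lim_seq_le_le (fun _ => 0%R) u v); auto using is_lim_seq_const.
Qed.

Lemma Clim_const (l : C) : filterlim (fun _ : nat => l) eventually (locally l).
Proof. apply filterlim_const. Qed.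

Lemma Clim_shift (J : nat) (u : nat -> C) (l : C) :
  filterlim (fun n => u (J + n)%nat) eventually (locally l) ->
  filterlim u eventually (locally l).
Proof.
rewrite !Clim_iff; intros H.
apply (is_lim_seq_incr_n _ J).
now apply (is_lim_seq_ext _ _ _ (fun n => f_equal (fun m => Cmod (u m - l)) (Nat.add_comm J n))).
Qed.

Lemma Clim_plus (u v : nat -> C) (l m : C) :
  filterlim u eventually (locally l) -> filterlim v eventually (locally m) ->
  filterlim (fun n => u n + v n) eventually (locally (l + m)).
Proof.
rewrite !Clim_iff; intros Hu Hv.
apply (is_lim_seq_squeeze0 _ (fun n => Cmod (u n - l) + Cmod (v n - m))%R).
- intros n; split; [apply Cmod_ge_0|].
  replace (u n + v n - (l + m)) with ((u n - l) + (v n - m)) by ring; apply Cmod_triangle.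
- rewrite <- (Rplus_0_r 0); now apply is_lim_seq_plus'.
Qed.

Lemma Clim_mult (u v : nat -> C) (l m : C) :
  filterlim u eventually (locally l) -> filterlim v eventually (locally m) ->
  filterlim (fun n => u n * v n) eventually (locally (l * m)).
Proof.
rewrite !Clim_iff; intros Hu Hv.
apply (is_lim_seq_squeeze0 _ (fun n => Cmod (u n - l) * Cmod (v n - m) +
  (Cmod (u n - l) * Cmod m + Cmod l * Cmod (v n - m)))%R).
- intros n; split; [apply Cmod_ge_0|].
  replace (u n * v n - l * m) with
    ((u n - l) * (v n - m) + ((u n - l) * m + l * (v n - m))) by ring.
  rewrite <- !Cmod_mult.
  eapply Rle_trans; [apply Cmod_triangle|].
  apply Rplus_le_compat_l, Cmod_triangle.
- replace (Finite 0) with (Finite (0 * 0 + (0 * Cmod m + Cmod l * 0))%R) by (f_equal; ring).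
  repeat apply is_lim_seq_plus'; apply is_lim_seq_mult'; auto using is_lim_seq_const.
Qed.

Lemma Clim_Cmod (u : nat -> C) (l : C) :
  filterlim u eventually (locally l) -> is_lim_seq (fun n => Cmod (u n)) (Cmod l).
Proof.
exact (fun H => filterlim_comp _ _ _ _ _ _ _ _ H (@filterlim_norm C_AbsRing C_NormedModule l)).
Qed.

Lemma Clim_inv (u : nat -> C) (l : C) :
  (forall n, u n <> 0) -> l <> 0 ->
  filterlim u eventually (locally l) ->
  filterlim (fun n => / u n) eventually (locally (/ l)).
Proof.
intros Hu0 Hl0 Hu; apply Clim_iff.
apply (is_lim_seq_ext (fun n => Cmod (u n - l) / (Cmod (u n) * Cmod l))%R).
- intros n; rewrite <- Cmod_mult, <- Cmod_div by (now apply Cmult_neq_0).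
  rewrite <- Cmod_opp; f_equal; field; auto.
- replace (Finite 0) with (Finite (0 / (Cmod l * Cmod l))%R)
    by (f_equal; field; apply Rgt_not_eq, Cmod_gt_0, Hl0).
  apply is_lim_seq_div'.
  + now apply Clim_iff.
  + apply is_lim_seq_mult'; [now apply Clim_Cmod | apply is_lim_seq_const].
  + apply Rmult_integral_contrapositive_currified; apply Rgt_not_eq, Cmod_gt_0, Hl0.
Qed.

Lemma Clim_bounded (u : nat -> C) (l : C) :
  filterlim u eventually (locally l) -> exists B, forall n, (Cmod (u n) <= B)%R.
Proof.
intros H.
destruct (@filterlim_bounded C_AbsRing C_NormedModule u (ex_intro _ l H)) as [B HB].
now exists B.
Qed.

Lemma Clim_unique (u : nat -> C) (l m : C) :
  filterlim u eventually (locally l) -> filterlim u eventually (locally m) -> l = m.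
Proof. intros Hl Hm; now rewrite <- (CLim_seq_unique u l Hl), <- (CLim_seq_unique u m Hm). Qed.

(** * Absolute summability and Tannery's theorem *)

Lemma csum_Cmod_le (f : nat -> C) (n : nat) :
  (Cmod (csum f n) <= sum_n (fun k => Cmod (f k)) n)%R.
Proof. exact (@norm_sum_n_m C_AbsRing C_NormedModule f 0 n). Qed.

Lemma ex_Cseries_abs (f : nat -> C) :
  ex_series (fun k => Cmod (f k)) -> ex_Cseries f.
Proof.
apply (@ex_series_le C_AbsRing C_CompleteNormedModule); intros n; apply Rle_refl.
Qed.

Lemma is_lim_seq_sum0 (d : nat -> nat -> R) (K : nat) :
  (forall k, is_lim_seq (fun M => d M k) 0) ->
  is_lim_seq (fun M => sum_n (d M) K) 0.
Proof.
intros Hd; induction K as [|K IH].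
- apply (is_lim_seq_ext (fun M => d M O)); [intros M; symmetry; apply sum_O | apply Hd].
- apply (is_lim_seq_ext (fun M => sum_n (d M) K + d M (S K))%R).
  + intros M; symmetry; exact (sum_Sn (d M) K).
  + rewrite <- (Rplus_0_r 0); now apply is_lim_seq_plus'.
Qed.

(** Cut at a [K] independent of [M]: the head is a fixed finite sum of null sequences, and the rest
    is at most a tail of [g]. *)
Lemma is_lim_seq_sum0_dominated (d : nat -> nat -> R) (g : nat -> R) :
  (forall M k, (0 <= d M k)%R) ->
  (forall M k, (k <= M)%nat -> (d M k <= g k)%R) ->
  ex_series g ->
  (forall k, is_lim_seq (fun M => d M k) 0) ->
  is_lim_seq (fun M => sum_n (d M) M) 0.
Proof.
intros Hd0 Hdg [G HG] Hd.
assert (split_le : forall M K n, (K + n <= M)%nat ->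
  (sum_n (d M) (K + n) <= sum_n (d M) K + (sum_n g (K + n) - sum_n g K))%R).
{ intros M K n; induction n as [|n IH]; intros HM.
  - rewrite Nat.add_0_r; lra.
  - rewrite Nat.add_succ_r, !sum_Sn; unfold plus; simpl.
    specialize (IH ltac:(lia)); specialize (Hdg M (S (K + n)) ltac:(lia)); lra. }
assert (HG' : is_lim_seq (sum_n g) G) by exact HG.
apply is_lim_seq_spec; intros eps.
(* One quarter goes to the head; two go to the tail, since the partial sums of [g] at [K] and at [M]
   are each within [eps / 4] of [G]. *)
assert (Heps : (0 < eps / 4)%R) by (pose proof (cond_pos eps); lra).
apply is_lim_seq_spec in HG'.
destruct (HG' (mkposreal _ Heps)) as [K HK]; simpl in HK.
pose proof (is_lim_seq_sum0 d K Hd) as Hfin; apply is_lim_seq_spec in Hfin.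
destruct (Hfin (mkposreal _ Heps)) as [N HN]; simpl in HN.
exists (K + N)%nat; intros M HM.
specialize (HN M ltac:(lia)); specialize (split_le M K (M - K)%nat ltac:(lia)).
replace (K + (M - K))%nat with M in split_le by lia.
pose proof (HK K ltac:(lia)) as HK1; pose proof (HK M ltac:(lia)) as HK2.
apply Rabs_def2 in HN, HK1, HK2.
assert (0 <= sum_n (d M) M)%R.
(* Only the upper bound is generalized, so that the induction keeps the row [d M] fixed. *)
{ clear -Hd0; generalize M at 2; intros n; induction n as [|n IH].
  - rewrite sum_O; apply Hd0.
  - rewrite sum_Sn; unfold plus; simpl; specialize (Hd0 M (S n)); lra. }
apply Rabs_def1; lra.
Qed.

(** The weighted sum differs from the plain one by the sum of [(w M k - 1) * t k], which is
    dominated by [(B + 1) * Cmod (t k)] and tends to 0 termwise. *)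
Lemma Clim_weighted_csum (w : nat -> nat -> C) (t : nat -> C) (B : R) (s : C) :
  (forall M k, (k <= M)%nat -> (Cmod (w M k) <= B)%R) ->
  (forall k, filterlim (fun M => w M k) eventually (locally (RtoC 1))) ->
  ex_series (fun k => Cmod (t k)) ->
  filterlim (csum t) eventually (locally s) ->
  filterlim (fun M => csum (fun k => w M k * t k) M) eventually (locally s).
Proof.
intros HB Hw Ht HS.
assert (E : forall M, csum t M + csum (fun k => (w M k - 1) * t k) M =
  csum (fun k => w M k * t k) M).
{ intros M; rewrite <- csum_plus; apply csum_eq; intros; ring. }
apply (filterlim_ext _ _ E).
replace s with (s + 0) by ring.
apply Clim_plus; [exact HS|].
apply Clim_iff.
apply (is_lim_seq_squeeze0 _ (fun M => sum_n (fun k => Cmod ((w M k - 1) * t k)) M)).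
{ intros M; split; [apply Cmod_ge_0|].
  unfold Cminus at 1; rewrite Copp_0, Cplus_0_r; apply csum_Cmod_le. }
apply (is_lim_seq_sum0_dominated _ (fun k => (B + 1) * Cmod (t k))%R).
- intros; apply Cmod_ge_0.
- intros M k Hk; rewrite Cmod_mult; apply Rmult_le_compat_r; [apply Cmod_ge_0|].
  eapply Rle_trans; [apply Cmod_triangle|].
  rewrite Cmod_opp, Cmod_1; apply Rplus_le_compat_r; auto.
- now apply (@ex_series_scal R_AbsRing R_NormedModule).
- intros k; apply (is_lim_seq_ext (fun M => Cmod (w M k - 1) * Cmod (t k))%R).
  + intros M; now rewrite Cmod_mult.
  + replace (Finite 0) with (Finite (0 * Cmod (t k))%R) by (f_equal; ring).
    apply is_lim_seq_mult'; [now apply Clim_iff | apply is_lim_seq_const].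
Qed.

(** * Convergence of the products and series for [0 < |q| < 1] *)

Section Convergence.

Variable q : C.
Hypothesis hq0 : (0 < Cmod q)%R.
Hypothesis hq1 : (Cmod q < 1)%R.

(** Ratio test: consecutive terms have quotient [Z |q|^k], which tends to 0. *)
Lemma ex_series_gauss (Z : R) : (0 < Z)%R ->
  ex_series (fun k => Cmod q ^ (k * (k - 1) / 2) * Z ^ k)%R.
Proof.
intros HZ.
assert (pos : forall k, (0 < Cmod q ^ (k * (k - 1) / 2) * Z ^ k)%R).
{ intros k; apply Rmult_lt_0_compat; now apply pow_lt. }
apply ex_series_Rabs, (ex_series_DAlembert _ 0); [lra| |].
- intros k; apply Rgt_not_eq, pos.
- apply (is_lim_seq_ext (fun k => Z * Cmod q ^ k)%R).
  + intros k; rewrite tri_S, pow_add, Rabs_pos_eq.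
    * simpl; field; split; apply pow_nonzero, Rgt_not_eq; assumption.
    * rewrite <- pow_add, <- tri_S; apply Rlt_le, Rdiv_lt_0_compat; apply pos.
  + replace (Finite 0) with (Finite (Z * 0)%R) by (f_equal; ring).
    apply is_lim_seq_mult'; [apply is_lim_seq_const|].
    apply is_lim_seq_geom; rewrite Rabs_pos_eq; lra.
Qed.

Lemma Clim_qpow : filterlim (fun n => q ^ n) eventually (locally (RtoC 0)).
Proof.
apply Clim_iff, (is_lim_seq_ext (fun n => Cmod q ^ n)%R).
- intros n; rewrite <- Cmod_pow; f_equal; ring.
- apply is_lim_seq_geom; rewrite Rabs_pos_eq; lra.
Qed.

(** The bound telescopes: the product stays below 2 in modulus, so step [k] costs at most
    [2 |x| |q|^k], hence at most [(|q|^k - |q|^(k+1)) / 2]. *)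
Lemma qpoch_near_1 (x : C) (k : nat) : (Cmod x <= (1 - Cmod q) / 4)%R ->
  (Cmod (qpoch x q k - 1) <= (1 - Cmod q ^ k) / 2)%R.
Proof.
intros Hx; induction k as [|k IH].
- simpl; replace (1 - 1) with (RtoC 0) by ring; rewrite Cmod_0; lra.
- simpl qpoch.
  replace (qpoch x q k * (1 - x * q ^ k) - 1) with
    ((qpoch x q k - 1) + - (((qpoch x q k - 1) + 1) * (x * q ^ k))) by ring.
  eapply Rle_trans; [apply Cmod_triangle|].
  rewrite Cmod_opp, !Cmod_mult, Cmod_pow.
  assert (H2 : (Cmod (qpoch x q k - 1 + 1) <= 2)%R).
  { eapply Rle_trans; [apply Cmod_triangle|]; rewrite Cmod_1.
    pose proof (pow_le (Cmod q) k ltac:(lra)); lra. }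
  assert (Hp : (0 <= Cmod q ^ k)%R) by (apply pow_le; lra).
  assert (Cmod x * Cmod q ^ k <= (1 - Cmod q) / 4 * Cmod q ^ k)%R
    by (now apply Rmult_le_compat_r).
  assert (Cmod (qpoch x q k - 1 + 1) * (Cmod x * Cmod q ^ k) <=
    2 * ((1 - Cmod q) / 4 * Cmod q ^ k))%R.
  { apply Rmult_le_compat; auto; [apply Cmod_ge_0|].
    apply Rmult_le_pos; [apply Cmod_ge_0 | exact Hp]. }
  simpl; lra.
Qed.

(** The increments [- (qpoch x q k * (x * q ^ k))] are dominated by a geometric series. The limit is
    nonzero because the partial products stay at least 1/2 in modulus. *)
Lemma qpoch_small_cvg (x : C) : (Cmod x <= (1 - Cmod q) / 4)%R ->
  exists l : C, l <> 0 /\ filterlim (qpoch x q) eventually (locally l).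
Proof.
intros Hx.
assert (near : forall k, (Cmod (qpoch x q k - 1) <= 1 / 2)%R).
{ intros k; pose proof (qpoch_near_1 x k Hx); pose proof (pow_le (Cmod q) k ltac:(lra)); lra. }
destruct (ex_Cseries_abs (fun k => - (qpoch x q k * (x * q ^ k)))) as [s Hs].
{ apply (@ex_series_le R_AbsRing R_CompleteNormedModule _ (fun k => 2 * Cmod x * Cmod q ^ k)%R).
  - intros k; change (Rabs (Cmod (- (qpoch x q k * (x * q ^ k)))) <= 2 * Cmod x * Cmod q ^ k)%R.
    rewrite Rabs_pos_eq by apply Cmod_ge_0.
    rewrite Cmod_opp, !Cmod_mult, Cmod_pow, <- Rmult_assoc.
    apply Rmult_le_compat_r; [apply pow_le; lra|].
    apply Rmult_le_compat_r; [apply Cmod_ge_0|].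
    replace (qpoch x q k) with ((qpoch x q k - 1) + 1) by ring.
    eapply Rle_trans; [apply Cmod_triangle|]; rewrite Cmod_1; specialize (near k); lra.
  - apply (@ex_series_scal R_AbsRing R_NormedModule), ex_series_geom.
    rewrite Rabs_pos_eq; lra. }
assert (L : filterlim (qpoch x q) eventually (locally (1 + s))).
(* The increments with index up to [n] add up to [qpoch x q (S n) - 1]. *)
{ apply (Clim_shift 1).
  apply (filterlim_ext (fun n => 1 + csum (fun k => - (qpoch x q k * (x * q ^ k))) n)).
  - intros n; induction n as [|n IH].
    + rewrite csum_O; simpl; ring.
    + rewrite csum_S, Cplus_assoc, IH; simpl; ring.
  - apply Clim_plus; [apply Clim_const | exact Hs]. }
exists (1 + s); split; [|exact L].
intros H0; rewrite H0 in L; apply Clim_Cmod in L; rewrite Cmod_0 in L.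
assert (1 / 2 <= 0)%R; [|lra].
apply (is_lim_seq_le (fun _ => (1 / 2)%R) (fun n => Cmod (qpoch x q n)) (1 / 2)%R 0%R);
  auto using is_lim_seq_const.
intros n; specialize (near n).
pose proof (Cmod_triangle (qpoch x q n) (- (qpoch x q n - 1))) as T.
replace (qpoch x q n + - (qpoch x q n - 1)) with (RtoC 1) in T by ring.
rewrite Cmod_opp, Cmod_1 in T; lra.
Qed.

(** For large [J] the base [x * q ^ J] is small enough for the previous lemma; the limit can then
    vanish only through the finite factor [qpoch x q J]. *)
Lemma qpoch_cvg (x : C) : exists l : C,
  ((forall k, qpoch x q k <> 0) -> l <> 0) /\
  filterlim (qpoch x q) eventually (locally l).
Proof.
assert (exists J, Cmod (x * q ^ J) <= (1 - Cmod q) / 4)%R as [J HJ].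
{ pose proof (Clim_mult _ _ _ _ (Clim_const x) Clim_qpow) as H.
  apply Clim_iff, is_lim_seq_spec in H.
  assert (Heps : (0 < (1 - Cmod q) / 4)%R) by lra.
  destruct (H (mkposreal _ Heps)) as [J HJ]; exists J.
  specialize (HJ J (Nat.le_refl _)); simpl in HJ.
  rewrite Rminus_0_r, Rabs_pos_eq in HJ by apply Cmod_ge_0.
  replace (x * q ^ J - x * 0) with (x * q ^ J) in HJ by ring; lra. }
destruct (qpoch_small_cvg _ HJ) as [l [Hl0 Hl]].
exists (qpoch x q J * l); split.
- intros Hx; now apply Cmult_neq_0.
- apply (Clim_shift J).
  apply (filterlim_ext (fun n => qpoch x q J * qpoch (x * q ^ J) q n)).
  + intros n; now rewrite qpoch_add.
  + apply Clim_mult; [apply Clim_const | exact Hl].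
Qed.

Lemma qpoch_inf_correct (x : C) : qpoch_inf_cvg x q.
Proof.
destruct (qpoch_cvg x) as [l [_ Hl]].
unfold qpoch_inf_cvg, qpoch_inf; now rewrite (CLim_seq_unique _ _ Hl).
Qed.

Lemma qpoch_inf_neq0 (x : C) : (forall k, qpoch x q k <> 0) -> qpoch_inf x q <> 0.
Proof.
intros Hx; destruct (qpoch_cvg x) as [l [Hl0 Hl]].
unfold qpoch_inf; rewrite (CLim_seq_unique _ _ Hl); auto.
Qed.

Lemma qpoch_bounded (x : C) : exists B, forall k, (Cmod (qpoch x q k) <= B)%R.
Proof. exact (Clim_bounded _ _ (qpoch_inf_correct x)). Qed.

Lemma qpoch_inv_bounded (x : C) : (forall k, qpoch x q k <> 0) ->
  exists B, forall k, (Cmod (/ qpoch x q k) <= B)%R.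
Proof.
intros Hx; eapply Clim_bounded.
apply Clim_inv; [exact Hx | apply qpoch_inf_neq0, Hx | apply qpoch_inf_correct].
Qed.

Lemma qpoch_neq0 (x : C) : (forall m, x <> / q ^ m) -> forall k, qpoch x q k <> 0.
Proof.
intros Hx k; induction k as [|k IH]; simpl; [apply C1_nz|].
assert (Hqk : q ^ k <> 0) by (apply Cpow_nz, Cmod_gt_0, hq0).
apply Cmult_neq_0; [exact IH|]; intros H; apply (Hx k).
replace x with ((1 - (1 - x * q ^ k)) / q ^ k) by (field; exact Hqk).
rewrite H; field; exact Hqk.
Qed.

Lemma qpoch_qq_neq0 (k : nat) : qpoch q q k <> 0.
Proof.
induction k as [|k IH]; simpl; [apply C1_nz|].
apply Cmult_neq_0; [exact IH|]; intros H.
assert (E : q ^ S k = 1) by (simpl; replace (q * q ^ k) with (1 - (1 - q * q ^ k)) by ring;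
  rewrite H; ring).
apply (f_equal Cmod) in E; rewrite Cmod_pow, Cmod_1 in E.
pose proof (pow_lt_1_compat (Cmod q) (S k) ltac:(lra) ltac:(lia)); lra.
Qed.

(** All three q-Pochhammer factors are bounded uniformly in [k], which leaves a Gaussian-type
    series. *)
Lemma F_term_abs_summable (a c z : C) : (forall k, qpoch c q k <> 0) ->
  ex_series (fun k => Cmod (F_term q a c z k)).
Proof.
intros Hc.
destruct (qpoch_bounded a) as [Ba HBa].
destruct (qpoch_inv_bounded q qpoch_qq_neq0) as [Bq HBq].
destruct (qpoch_inv_bounded c Hc) as [Bc HBc].
(* [Cmod z + 1] replaces [Cmod z] because the ratio test needs a positive base and [z] may be 0. *)
apply (@ex_series_le R_AbsRing R_CompleteNormedModule _
  (fun k => (Ba * Bq * Bc) * (Cmod q ^ (k * (k - 1) / 2) * (Cmod z + 1) ^ k))%R).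
- intros k; change (Rabs (Cmod (F_term q a c z k)) <=
    (Ba * Bq * Bc) * (Cmod q ^ (k * (k - 1) / 2) * (Cmod z + 1) ^ k))%R.
  rewrite Rabs_pos_eq by apply Cmod_ge_0.
  replace (F_term q a c z k) with (qpoch a q k * / qpoch q q k * / qpoch c q k *
    (q ^ (k * (k - 1) / 2) * z ^ k) * (- (1)) ^ k)
    by (unfold F_term; field; split; first [apply Hc | apply qpoch_qq_neq0]).
  rewrite !Cmod_mult, !Cmod_pow, Cmod_opp, Cmod_1, pow1, Rmult_1_r.
  repeat (apply Rmult_le_compat; repeat apply Rmult_le_pos; try apply Cmod_ge_0;
    try (apply pow_le, Cmod_ge_0)); auto.
  + apply Rle_refl.
  + apply pow_incr; split; [apply Cmod_ge_0 | lra].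
- apply (@ex_series_scal R_AbsRing R_NormedModule), ex_series_gauss.
  pose proof (Cmod_ge_0 z); lra.
Qed.

Lemma qfall_bounded : exists B, forall M k, (k <= M)%nat -> (Cmod (qfall q M k) <= B)%R.
Proof.
destruct (qpoch_bounded q) as [B HB].
destruct (qpoch_inv_bounded q qpoch_qq_neq0) as [B' HB'].
exists (B * B')%R; intros M k Hk.
replace (qfall q M k) with (qpoch q q M * / qpoch q q (M - k))
  by (rewrite <- (qfall_qpoch q M k Hk); field; apply qpoch_qq_neq0).
rewrite Cmod_mult; apply Rmult_le_compat; auto using Cmod_ge_0.
Qed.

Lemma Clim_qfall (k : nat) :
  filterlim (fun M => qfall q M k) eventually (locally (RtoC 1)).
Proof.
induction k as [|k IH]; [apply Clim_const|].
replace (RtoC 1) with (1 * (1 + - (1) * 0)) by ring.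
apply (Clim_mult (fun M => qfall q M k) (fun M => 1 - q ^ (M - k))); [exact IH|].
(* Past index [k] the truncated difference [M - k] is genuine. *)
apply (Clim_shift k), (filterlim_ext (fun n => 1 + - (1) * q ^ n)).
- intros n; rewrite (Nat.add_comm k), Nat.add_sub; ring.
- apply Clim_plus, Clim_mult; try apply Clim_const; apply Clim_qpow.
Qed.

(** * Passage to the limit in the finite identity *)

Lemma F_cvg (a c z : C) : (forall k, qpoch c q k <> 0) ->
  filterlim (csum (F_term q a c z)) eventually (locally (F q a c z)).
Proof.
intros Hc.
destruct (ex_Cseries_abs _ (F_term_abs_summable a c z Hc)) as [s Hs].
unfold F; rewrite (CSeries_unique _ _ Hs); exact Hs.
Qed.

Lemma Clim_finite_sum (a c z : C) : (forall k, qpoch c q k <> 0) ->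
  filterlim (fun M => qpoch c q M * csum (fun k => qfall q M k * F_term q a c z k) M)
    eventually (locally (qpoch_inf c q * F q a c z)).
Proof.
intros Hc; destruct qfall_bounded as [B HB].
apply Clim_mult; [apply qpoch_inf_correct|].
apply (Clim_weighted_csum _ _ B); auto using Clim_qfall, F_term_abs_summable, F_cvg.
Qed.

(** Both sides are limits of finite sums that agree for every [M], by [finite_sum_conv] and
    [conv_swap]. *)
Lemma F_swap (a a' c z : C) :
  (forall k, qpoch c q k <> 0) -> (forall k, qpoch z q k <> 0) -> a * z = a' * c ->
  qpoch_inf c q * F q a c z = qpoch_inf z q * F q a' z c.
Proof.
intros Hc Hz Ha.
eapply Clim_unique; [apply Clim_finite_sum, Hc|].
eapply filterlim_ext; [|apply Clim_finite_sum, Hz].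
intros M; simpl; rewrite !finite_sum_conv by auto using qpoch_qq_neq0.
apply csum_eq; intros N _; f_equal; symmetry; apply conv_swap; auto using qpoch_qq_neq0.
Qed.

End Convergence.

(* The first five conjuncts say that every infinite sum and product in the
   identity converges and that the denominator (c;q)_oo is nonzero, so that
   the identity is not about default values of total operators. *)
Theorem theorem3p1 (q a c z : C)
  (hq0 : (0 < Cmod q)%R) (hq1 : (Cmod q < 1)%R)
  (hc0 : c <> 0)
  (hc : forall m : nat, c <> / q ^ m)
  (hz : forall m : nat, z <> / q ^ m) :
  let rhs_term (k : nat) : C :=
    qpoch (a * z / c) q k * (- (1)) ^ k * q ^ (k * (k - 1) / 2) * c ^ k
    / (qpoch q q k * qpoch z q k) in
  ex_Cseries (F_term q a c z) /\
  ex_Cseries rhs_term /\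
  qpoch_inf_cvg z q /\
  qpoch_inf_cvg c q /\
  qpoch_inf c q <> 0 /\
  F q a c z = qpoch_inf z q / qpoch_inf c q * CSeries rhs_term.
Proof.
intros rhs_term.
pose proof (qpoch_neq0 q hq0 c hc) as Hc.
pose proof (qpoch_neq0 q hq0 z hz) as Hz.
pose proof (qpoch_inf_neq0 q hq0 hq1 c Hc) as Hcinf.
split; [now apply ex_Cseries_abs, F_term_abs_summable|].
split; [exact (ex_Cseries_abs _ (F_term_abs_summable q hq0 hq1 (a * z / c) z c Hz))|].
split; [now apply qpoch_inf_correct|].
split; [now apply qpoch_inf_correct|].
split; [exact Hcinf|].
change (CSeries rhs_term) with (F q (a * z / c) z c).
transitivity (qpoch_inf c q * F q a c z / qpoch_inf c q); [field; exact Hcinf|].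
(* The side condition [a * z = a * z / c * c] uses [c <> 0]. *)
rewrite (F_swap q hq0 hq1 a (a * z / c) c z Hc Hz) by (field; exact hc0).
field; exact Hcinf.
Qed.
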